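(* There exists a Vitali metric measure space $(X,d,\mu)$ that satisfies, for each $1<p<\infty$, the $p$-Boman covering property (with some constant $C=C(p)>0$), and such that for all $q\in(1,\infty)$, $\|M^u_\mu\|_{L^q(\mu)\to L^q(\mu)}=\infty$.
   Context: A Borel measure $\mu$ on a metric space $(X,d)$ is $\tau$-additive if for every collection $\{U_\alpha\}_{\alpha\in\Lambda}$ of open sets, $\mu(\cup_\alpha U_\alpha)=\sup \mu(\cup_{i=1}^n U_{\alpha_i})$, the supremum being over all finite subcollections. A metric measure space $(X,d,\mu)$ is a metric space with a $\tau$-additive Borel measure $\mu$, not identically zero, that is finite on bounded Borel sets. $B(x,r)=\{y: d(x,y)<r\}$ and $B^{cl}(x,r)=\{y: d(x,y)\le r\}$; radii are always $>0$. The support of $\mu$ is the complement of $\cup\{B(x,r): x\in X,\ r>0,\ \mu B(x,r)=0\}$. $(X,d,\mu)$ is a Vitali metric measure space if for all $A\subset X$ and every covering $\mathcal{B}$ of $A$ by closed balls satisfying $\sup_{x\in A}\inf\{r>0: B^{cl}(x,r)\in\mathcal{B}\}=0$, there exists a disjoint subcollection $\mathcal{C}\subset\mathcal{B}$ such that $\mu(A\setminus\cup\mathcal{C})=0$. $(X,d,\mu)$ has the $p$-Boman covering property with constant $C>0$ if for all finite sequences of closed balls $\{B^{cl}(x_n,r_n)\}_{1\le n\le N}$ with $x_n$ in the support of $\mu$, of weights $\{w_n\}_{1\le n\le N}$ with $w_n>0$, and of dilations $\{t_n\}_{1\le n\le N}$ with $t_n\ge 1$, $$\left\| \sum_{1 \le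 n \le N}\frac{w_n \mathbf{1}_{B^{cl}(x_{n}, t_n r_{n})} }{\mu B^{cl}(x_{n}, t_n r_{n})} \right\|_{L^p(\mu)} \le C \left\| \sum_{1 \le n \le N}\frac{w_n \mathbf{1}_{B^{cl}(x_{n}, r_{n})} }{\mu B^{cl}(x_{n}, r_{n})} \right\|_{L^p(\mu)}.$$ The uncentered Hardy-Littlewood maximal operator is, for $g$ locally integrable, $$M^u_{\mu} g(x) := \sup _{\{r > 0,\ y\in X :\ d(x,y) < r,\ \mu B^{cl}(y, r) > 0\}} \frac{1}{\mu (B^{cl}(y, r))} \int _{B^{cl}(y, r)} |g| \, d\mu .$$ $\|M^u_\mu\|_{L^q(\mu)\to L^q(\mu)}$ is the smallest $c\in[0,\infty]$ with $\|M^u_\mu g\|_{L^q(\mu)}\le c\|g\|_{L^q(\mu)}$ for all $g\in L^q(\mu)$. *)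

(* Defs.v *)
From HB Require Import structures.
From mathcomp Require Import all_boot all_order all_algebra.
From mathcomp Require Import all_classical all_reals all_analysis.

Set Implicit Arguments.
Unset Strict Implicit.
Unset Printing Implicit Defensive.

Import Order.TTheory GRing.Theory Num.Theory.
Import numFieldNormedType.Exports.

Local Open Scope classical_set_scope.
Local Open Scope ring_scope.

(* The library's measurable types are pointed. This loses no generality: a
   space carrying a nonzero measure is nonempty. *)
#[short(type="pmetricType")]
HB.structure Definition PointedMetric (K : numDomainType) :=
  { M of Pointed M & Metric K M }.

Definition borel (R : realType) (X : pmetricType R) :=
  g_sigma_algebraType (@open X).

(* Not the library's [closed_ball], which is the closure of the open ball. *)
Definition cball (R : realType) (X : pmetricType R) (x : X) (r : R) : set X :=
  [set y | mdist x y <= r].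

Section metric_measure.
Context (R : realType) (X : pmetricType R).
Variable mu : {measure set (borel X) -> \bar R}.
Local Open Scope ereal_scope.

Definition tau_additive :=
  forall (I : Type) (U : I -> set X), (forall i, open (U i)) ->
    mu (\bigcup_i U i) =
    ereal_sup [set mu (\bigcup_(i in F) U i) | F in [set F | finite_set F]].

Definition bounded_subset (A : set X) :=
  exists M : R, forall x y, A x -> A y -> (mdist x y <= M)%R.

Definition metric_measure_space :=
  [/\ tau_additive,
      mu [set: borel X] != 0 &
      forall A : set (borel X),
        measurable A -> bounded_subset A -> mu A < +oo].

Definition measure_support : set X :=
  ~` \bigcup_(xr in [set xr : X * R | (0 < xr.2)%R /\ mu (ball xr.1 xr.2) = 0])
       ball xr.1 xr.2.

Definition closed_ball_family (B : set (set X)) :=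
  forall S, B S -> exists x r, (0 < r)%R /\ S = cball x r.

(* The supremum and infimum are taken in [\bar R], so that the infimum is +oo
   at a point that is the center of no ball of B. Since A `\` \bigcup C need
   not be a Borel set, its having measure zero is [mu.-negligible]. For
   A = set0 the supremum is -oo, but then the conclusion is trivial. *)
Definition vitali_space :=
  forall (A : set X) (B : set (set X)),
    closed_ball_family B ->
    A `<=` \bigcup_(S in B) S ->
    ereal_sup [set ereal_inf [set r%:E | r in
                 [set r : R | (0 < r)%R /\ B (cball x r)]] | x in A] = 0 ->
    exists C : set (set X),
      [/\ C `<=` B, trivIset C id &
          mu.-negligible (A `\` \bigcup_(S in C) S)].

(* x |-> \sum_n w_n 1_{B_n}(x) / mu(B_n), where B_n is the closed ball with
   center x_n and radius s_n. *)
Definition weighted_ball_sum (N : nat) (x : 'I_N -> X) (s w : 'I_N -> R)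
    (y : borel X) : \bar R :=
  \sum_(n < N)
    ((w n)%:E * (\1_(cball (x n) (s n)) y)%:E / mu (cball (x n) (s n))).

Definition boman_covering (p C : R) :=
  forall (N : nat) (x : 'I_N -> X) (r w t : 'I_N -> R),
    (forall n, measure_support (x n)) ->
    (forall n, 0 < r n)%R ->
    (forall n, 0 < w n)%R ->
    (forall n, 1 <= t n)%R ->
    'N[mu]_p%:E [weighted_ball_sum x (fun n => (t n * r n)%R) w] <=
    C%:E * 'N[mu]_p%:E [weighted_ball_sum x r w].

(* Total in g; it is meant for g locally integrable, as is the case of the
   elements of L^q. *)
Definition uncentered_maximal (g : borel X -> R) (x : borel X) : \bar R :=
  ereal_sup
    [set (\int[mu]_(z in cball yr.1 yr.2) `|g z|%:E) / mu (cball yr.1 yr.2)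
    | yr in [set yr : X * R | [/\ (0 < yr.2)%R, (mdist (x : X) yr.1 < yr.2)%R &
                                  0 < mu (cball yr.1 yr.2)]]].

Definition maximal_opnorm (q : R) : \bar R :=
  ereal_inf [set c : \bar R | 0 <= c /\
    forall g : borel X -> R, g \in Lfun mu q%:E ->
      'N[mu]_q%:E [uncentered_maximal g] <= c * 'N[mu]_q%:E [EFin \o g]].

End metric_measure.

(* Main.v *)
Require Import Defs.
From HB Require Import structures.
From mathcomp Require Import all_boot all_order all_algebra.
From mathcomp Require Import all_classical all_reals all_analysis.
From mathcomp Require Import measurable_realfun ring lra.

(** The space is designed so that, up to null sets, the balls centered in the
    support are pairwise nested or disjoint, whereas the balls centered off the
    support are not.

    Its points are atoms [a_i], indexed by the naturals, and links [l_(j,k)],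
    indexed by pairs.  Distinct points are at distance 2, except that a link
    [l_(j,k)] is at distance 1 from [a_j] and from [a_k]; a function with values
    in {1, 2} off the diagonal is automatically a distance.  The measure gives
    mass [1/((i+1)(i+2))] to [a_i] and nothing to the links; its total mass is
    1 by telescoping, and its support is the set of atoms.

    The topology is discrete, so that the balls of small radius of a fine
    covering are singletons, and the Vitali property is immediate
    ([discrete_vitali]).

    Boman: up to a null set, a closed ball centered at an atom is that atom
    alone if its radius is less than 2, and it is the whole space otherwise.
    Dilating a ball thus either changes nothing or replaces its normalized
    indicator with the constant 1 ([density_dilate]).  If [F] is the weighted
    sum of the normalized indicators, the dilated sum is at most
    [F + \sum_n w_n], and [\sum_n w_n = \int F <= ||F||_p] because the measure
    is a probability.  By Minkowski, the constant 2 works for every [p].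

    Maximal operator: the ball of radius 3/2 about [l_(k,i)] meets the atoms in
    [a_k] and [a_i] only.  For [i >= k], the atom [a_i] is not heavier than
    [a_k], hence the maximal function of the indicator of [a_k] is at least 1/2
    at [a_i] ([maximal_atom]).  The atoms of index between [k] and [2k] have
    total mass [(k+2)/2] times that of [a_k], so the operator norm on [L^q] is
    at least [((k+2)/2)^(1/q) / 2] for every [k]. *)

Set Implicit Arguments.
Unset Strict Implicit.
Unset Printing Implicit Defensive.

Import Order.TTheory GRing.Theory Num.Theory.
Import numFieldNormedType.Exports.

Local Open Scope classical_set_scope.
Local Open Scope ring_scope.

(** * Norms, and discrete spaces *)

Section Lnorm_lemmas.
Context d (T : measurableType d) (R : realType).
Variable mu : {measure set T -> \bar R}.
Local Open Scope ereal_scope.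

Lemma Lnorm_scale_indic (p c : R) (A : set T) : (0 < p)%R -> (0 <= c)%R ->
  measurable A ->
  'N[mu]_p%:E [(fun x => (c * \1_A x)%:E)] = c%:E * mu A `^ p^-1.
Proof.
move=> p0 c0 mA; rewrite unlock /=.
rewrite (eq_integral (fun x => (c `^ p)%:E * (\1_A x)%:E)); last first.
  move=> x _; rewrite indicE; case: (x \in A).
    by rewrite !mulr1 mule1 ger0_norm.
  by rewrite !mulr0 mule0 normr0 powR0// gt_eqF.
rewrite ge0_integralZl_EFin ?powR_ge0//; last first.
  by apply/measurable_EFinP; exact: measurable_indic.
rewrite integral_indic// setIT poweRM ?lee_fin ?powR_ge0//.
by rewrite poweR_EFin -powRrM mulfV ?gt_eqF// powRr1.
Qed.

(** Hoelder's inequality against the constant function 1. *)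
Lemma Lnorm1_le (p : R) (f : T -> R) : mu setT = 1 -> (1 < p)%R ->
  measurable_fun setT f -> 'N[mu]_1 [EFin \o f] <= 'N[mu]_p%:E [EFin \o f].
Proof.
move=> mu1 p1 mf; have p0 : (0 < p)%R := lt_trans ltr01 p1.
have q0 : (0 < (1 - p^-1)^-1)%R by rewrite invr_gt0 subr_gt0 invf_lt1.
have := @hoelder _ _ _ mu f (cst 1%R) p _ mf (measurable_cst _) p0 q0.
rewrite invrK subrKC => /(_ erefl).
rewrite [X in _ * X](_ : _ = 1) ?mule1; last first.
  by rewrite (eq_Lnorm _ _ (g := cst 1))// Lnorm_cst1 mu1 poweR1r.
apply: le_trans; rewrite le_eqVlt; apply/orP; left; apply/eqP.
by apply: eq_Lnorm => x /=; rewrite mulr1.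
Qed.

End Lnorm_lemmas.

(** Every point of [A] is the center of a ball of [B] that is reduced to that
    point, so the singletons form a disjoint subfamily covering all of [A]. *)
Lemma discrete_vitali (R : realType) (X : pmetricType R)
    (mu : {measure set (borel X) -> \bar R}) :
  (forall x : X, open [set x]) -> vitali_space mu.
Proof.
move=> dX A B _ _ supB; exists [set [set x] | x in A]; split.
- move=> _ [x Ax <-].
  have /(@nbhs_ballP R)[e /= e0 xe] : nbhs x [set x].
    exact: open_nbhs_nbhs.
  have : (ereal_inf [set r%:E | r in
      [set r : R | (0 < r)%R /\ B (cball x r)]] < e%:E)%E.
    apply: (@le_lt_trans _ _ 0%E); last by rewrite lte_fin.
    by rewrite -supB; apply: ereal_sup_ubound; exists x.
  move=> /ereal_inf_lt[_ [r /= [r0 Br] <-]]; rewrite lte_fin => re.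
  suff <- : cball x r = [set x] by [].
  apply/seteqP; split=> [y /= xy|_ ->]; last by rewrite /cball/= mdistxx ltW.
  by apply: xe; rewrite ballEmdist/=; exact: le_lt_trans re.
- by move=> _ _ [x _ <-] [y _ <-] [z [-> ->]].
- rewrite [X in _.-negligible X](_ : _ = set0); first exact: negligible_set0.
  by apply/seteqP; split=> // x [Ax]; apply; exists [set x] => //; exists x.
Qed.

(** * The space of atoms and links *)

(** The metric takes values in [R], hence the phantom parameter. *)
Definition site (R : realType) : Type := (nat + nat * nat)%type.

HB.instance Definition _ (R : realType) :=
  Choice.copy (site R) (nat + nat * nat)%type.

Section site_metric.
Variable R : realType.

Definition atom i : site R := inl i.
Definition link i j : site R := inr (i, j).

HB.instance Definition _ := isPointed.Build (site R) (atom 0).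

Definition linked (x y : site R) : bool :=
  match x, y with
  | inl i, inr (j, k) | inr (j, k), inl i => (i == j) || (i == k)
  | _, _ => false
  end.

Definition site_dist (x y : site R) : R :=
  if x == y then 0 else if linked x y then 1 else 2.

Let site_distxx x : site_dist x x = 0.
Proof. by rewrite /site_dist eqxx. Qed.

Let site_dist_pos x y : site_dist x y = 0 -> x = y.
Proof.
rewrite /site_dist; case: eqP => // _; case: linked => /eqP.
  by rewrite oner_eq0.
by rewrite pnatr_eq0.
Qed.

Let site_dist_sym x y : site_dist x y = site_dist y x.
Proof. by rewrite /site_dist eq_sym; case: x y => [?|[? ?]] [?|[? ?]]. Qed.

Let site_dist_triangle y x z : site_dist x z <= site_dist x y + site_dist y z.
Proof.
rewrite /site_dist; have [->|xy] := eqVneq x y; first by rewrite add0r.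
have [<-|yz] := eqVneq y z; first by rewrite (negbTE xy) addr0.
by case: (x == z) => /=; case: (linked x z); case: (linked x y);
  case: (linked y z) => /=; lra.
Qed.

HB.instance Definition _ := isMetric.Build R (site R)
  site_distxx site_dist_pos site_dist_sym site_dist_triangle.

Lemma mdist_siteE (x y : site R) : mdist x y = site_dist x y.
Proof. by []. Qed.

End site_metric.

(** * The measure *)

Section site_measure.
Variable R : realType.
Local Notation atom := (@atom R).
Local Notation link := (@link R).

(** The masses must be summable and yet decrease so slowly that the atoms
    [a_k, ..., a_2k] together outweigh [a_k] by an unbounded factor. *)
Definition mass (i : nat) : {nonneg R} := ((i.+1 * i.+2)%:R^-1)%:nng.

Definition site_measure : {measure set (borel (site R)) -> \bar R} :=
  mseries (fun i => mscale (mass i) (dirac (atom i : borel (site R)))) 0.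

Local Notation mu := site_measure.
Local Open Scope ereal_scope.

Lemma mass_gt0 i : (0 < (mass i)%:num)%R.
Proof. by rewrite /= invr_gt0 ltr0n. Qed.

Lemma sum_mass m n : (m <= n)%N ->
  \sum_(m <= i < n) (mass i)%:num%:E = (m.+1%:R^-1 - n.+1%:R^-1)%:E.
Proof.
move=> mn; rewrite sumEFin; congr EFin.
rewrite -[RHS]opprB -(telescope_sumr (fun i => i.+1%:R^-1 : R)%R mn) -sumrN.
apply: eq_bigr => i _; rewrite /= opprB natrM.
field.
by rewrite nat1r -natrD !pnatr_eq0.
Qed.

Lemma site_measureE A :
  mu A = \sum_(i <oo) ((mass i)%:num%:E * (\1_A (atom i))%:E).
Proof. by []. Qed.

Lemma site_open (A : set (site R)) : open A.
Proof.
rewrite openE => x Ax; apply/(@nbhs_ballP R); exists 1%R => //= y.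
rewrite ballEmdist /= mdist_siteE /site_dist; case: eqP => [<-//|_].
by case: linked; lra.
Qed.

Lemma site_measurable (A : set (borel (site R))) : measurable A.
Proof. by apply: sub_sigma_algebra; exact: site_open. Qed.

Lemma site_measurable_fun d (T : measurableType d) (f : borel (site R) -> T) D :
  measurable_fun D f.
Proof. by move=> _ B _; exact: site_measurable. Qed.

Lemma sum_mass_le_site_measure m n A :
  (forall i, (m <= i < n)%N -> A (atom i)) ->
  \sum_(m <= i < n) (mass i)%:num%:E <= mu A.
Proof.
move=> h; rewrite site_measureE.
rewrite (_ : \sum_(m <= i < n) _ =
  \sum_(m <= i < n) ((mass i)%:num%:E * (\1_A (atom i))%:E)); last first.
  apply: eq_big_nat => i mi; rewrite indicE mem_set ?mule1//; exact: h.
apply: le_trans (nneseries_lim_ge n _); last first.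
  by move=> i _ _; rewrite mule_ge0// lee_fin.
have [mn|mn] := leqP m n; last by rewrite big_geq ?sume_ge0// ltnW.
rewrite [leRHS](big_cat_nat (leq0n m) mn) /=.
apply: leeDr; exact: sume_ge0.
Qed.

Lemma site_measure_le (x : \bar R) A :
  (forall n, \sum_(0 <= i < n) ((mass i)%:num%:E * (\1_A (atom i))%:E) <= x) ->
  mu A <= x.
Proof.
move=> h; rewrite site_measureE; apply: lime_le.
  by apply: is_cvg_nneseries => i _ _; rewrite mule_ge0// lee_fin.
by apply: nearW.
Qed.

Lemma site_measure_setT : mu setT = 1.
Proof.
apply/eqP; rewrite eq_le; apply/andP; split.
  apply: site_measure_le => n; under eq_bigr do rewrite indicT mule1.
  by rewrite sum_mass// lee_fin invr1 gerBl invr_ge0.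
apply/lee_addgt0Pr => e e0.
have [n ne] : exists n, (n.+1%:R^-1 <= e)%R.
  exists (Num.truncn e^-1); rewrite -[leRHS]invrK lef_pV2 ?posrE ?invr_gt0//.
  exact/ltW/truncnS_gt.
rewrite -leeBlDr//.
apply: le_trans (sum_mass_le_site_measure (m := 0) (n := n) _) => //.
by rewrite sum_mass// invr1 lee_fin lerB.
Qed.

Lemma site_measure_le1 A : mu A <= 1.
Proof.
by rewrite -site_measure_setT le_measure ?inE//; exact: site_measurable.
Qed.

Lemma site_measure_set1 i : mu [set atom i] = (mass i)%:num%:E.
Proof.
apply/eqP; rewrite eq_le; apply/andP; split; last first.
  have := @sum_mass_le_site_measure i i.+1 [set atom i].
  rewrite big_nat1; apply => j.
  by rewrite ltnS -eqn_leq => /eqP <-.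
apply: site_measure_le => n; have [ni|ni] := ltnP i n; last first.
  rewrite big_nat big1 => [|j /andP[_ jn]]; first by rewrite lee_fin.
  rewrite indicE memNset ?mule0// => -[ji]; move: jn; rewrite ji ltnNge ni//.
rewrite (bigD1_seq i) ?mem_index_iota//= ?iota_uniq// big1 => [|j ji];
    last first.
  rewrite indicE memNset ?mule0// => -[ij]; move: ji; rewrite ij eqxx//.
by rewrite indicE mem_set// mule1 adde0.
Qed.

Lemma le_site_measure_atoms (A B : set (site R)) :
  (forall i, A (atom i) -> B (atom i)) -> mu A <= mu B.
Proof.
move=> AB; rewrite !site_measureE; apply: lee_nneseries => i _.
  by rewrite mule_ge0// lee_fin.
rewrite lee_wpmul2l// lee_fin// !indicE.
have [/[!inE] Ai|_] := boolP (atom i \in A); last by [].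
by rewrite mem_set//; exact: AB.
Qed.

Lemma eq_site_measure_atoms (A B : set (site R)) :
  (forall i, A (atom i) <-> B (atom i)) -> mu A = mu B.
Proof.
by move=> AB; apply/eqP; rewrite eq_le !le_site_measure_atoms// => i /AB.
Qed.

Lemma integral_site (f : borel (site R) -> \bar R) : (forall x, 0 <= f x) ->
  \int[mu]_x f x = \sum_(i <oo) ((mass i)%:num%:E * f (atom i)).
Proof.
move=> f0; rewrite ge0_integral_measure_series//; last first.
  exact: site_measurable_fun.
apply: eq_eseriesr => i _.
rewrite ge0_integral_mscale//; last exact: site_measurable_fun.
by rewrite integral_dirac// ?diracT ?mul1e//; exact: site_measurable_fun.
Qed.

(** The comparison is required at the atoms only, since the links are null. *)
Lemma Lnorm_site_le (p : R) (f g : borel (site R) -> \bar R) : (0 < p)%R ->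
  (forall i, `|f (atom i)| <= `|g (atom i)|) ->
  'N[mu]_p%:E [f] <= 'N[mu]_p%:E [g].
Proof.
move=> p0 fg; rewrite unlock /=.
have pow0 (h : borel (site R) -> \bar R) x : 0 <= `|h x| `^ p.
  exact: poweR_ge0.
apply: gt0_ler_poweR;
  rewrite ?invr_ge0 ?(ltW p0)// ?in_itv/= ?integral_ge0// ?leey//.
rewrite !integral_site//; apply: lee_nneseries => i _.
  by rewrite mule_ge0// lee_fin.
rewrite lee_wpmul2l// ?lee_fin//; apply: gt0_ler_poweR => //.
- exact: ltW.
- by rewrite in_itv/= abse_ge0 leey.
- by rewrite in_itv/= abse_ge0 leey.
Qed.

(** For tau-additivity, a partial sum of the series that defines the measure of
    a union sees finitely many atoms, which are covered by finitely many members
    of the family. *)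
Lemma site_metric_measure : metric_measure_space mu.
Proof.
split.
- move=> I U oU; apply/eqP; rewrite eq_le; apply/andP; split; last first.
    apply: ge_ereal_sup => _ [F _ <-]; apply: le_measure.
    + by rewrite inE; exact: site_measurable.
    + by rewrite inE; exact: site_measurable.
    + by move=> x [i _ Ux]; exists i.
  apply: site_measure_le => n.
  have /choice[s sP] i : exists o : option I, (\bigcup_i U i) (atom i) ->
      exists2 k, o = Some k & U k (atom i).
    have [[k _ Uk]|nU] := pselect ((\bigcup_i U i) (atom i)).
      by exists (Some k) => _; exists k.
    by exists None.
  pose F := [set k | exists2 i, (i < n)%N & s i = Some k].
  have finF : finite_set F.
    apply: (@sub_finite_set _ _ (\bigcup_(i in `I_n) [set k | s i = Some k])).
      by move=> k [i ilt sik]; exists i.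
    apply: bigcup_finite; first exact: finite_II.
    move=> i _; case: (s i) => [k|]; last first.
      by rewrite (_ : mkset _ = set0)// -subset0 => k.
    by rewrite (_ : mkset _ = [set k]) //; apply/seteqP; split=> j /= [->].
  apply: (@le_trans _ _ (mu (\bigcup_(i in F) U i))); last first.
    by apply: ereal_sup_ubound; exists F.
  rewrite site_measureE; apply: le_trans (nneseries_lim_ge n _); last first.
    by move=> i _ _; rewrite mule_ge0// lee_fin.
  rewrite big_nat [leRHS]big_nat; apply: lee_sum => i /andP[_ ilt].
  rewrite lee_wpmul2l// ?lee_fin// !indicE.
  have [/[!inE] Ui|_] := boolP (atom i \in \bigcup_i U i); last by [].
  rewrite mem_set//; have [k sk Uk] := sP _ Ui.
  by exists k => //; exists i.
- by rewrite site_measure_setT oner_neq0.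
- by move=> A _ _; apply: le_lt_trans (site_measure_le1 A) _; rewrite ltry.
Qed.

(** * The Boman covering property *)

(** A link is isolated and has measure zero, so it lies off the support. *)
Lemma site_support x : measure_support mu x -> exists i, x = atom i.
Proof.
case: x => [i _|[j k]]; first by exists i.
rewrite /measure_support/= => sx; exfalso; apply: sx.
exists (link j k, 1%R) => /=; last by rewrite ballEmdist/= mdistxx.
split=> //; rewrite (@eq_site_measure_atoms _ set0) ?measure0// => i.
split=> //.
rewrite ballEmdist/= mdist_siteE /site_dist/=.
by case: ifP => _; lra.
Qed.

Lemma cball_atom_small i (s : R) : (0 < s < 2)%R ->
  forall j, cball (atom i) s (atom j) <-> [set atom i] (atom j).
Proof.
move=> /andP[s0 s2] j; rewrite /cball/= mdist_siteE /site_dist /=; split.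
  by case: eqP => [->|_] //= h; exfalso; lra.
by move=> [->]; rewrite eqxx ltW.
Qed.

Lemma cball_atom_large i (s : R) : (2 <= s)%R -> cball (atom i) s = setT.
Proof.
move=> s2; apply/seteqP; split=> // y _; rewrite /cball/=.
by rewrite mdist_siteE /site_dist; case: eqP => _; [lra|case: linked; lra].
Qed.

(** The normalized indicator of the closed ball of radius [s] about [atom i], up
    to its values on the links. *)
Definition density i (s : R) (y : borel (site R)) : R :=
  if (s < 2)%R then ((mass i)%:num^-1 * \1_[set atom i] y)%R else 1%R.

Lemma density_ge0 i s y : (0 <= density i s y)%R.
Proof. by rewrite /density; case: ifP => // _; rewrite mulr_ge0// invr_ge0. Qed.

Lemma normalized_ball_atom (w s : R) i j : (0 < s)%R ->
  w%:E * (\1_(cball (atom i) s) (atom j))%:E / mu (cball (atom i) s) =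
  (w * density i s (atom j))%:E.
Proof.
move=> s0; rewrite /density; have [s2|s2] := ltP s 2%R.
  have hs : (0 < s < 2)%R by rewrite s0.
  rewrite (eq_site_measure_atoms (cball_atom_small i hs)).
  rewrite site_measure_set1 inver gt_eqF ?mass_gt0//.
  rewrite -!EFinM; congr EFin; rewrite -mulrA; congr (_ * _)%R.
  rewrite mulrC; congr (_ * _)%R; rewrite !indicE.
  suff -> : (atom j \in cball (atom i) s) = (atom j \in [set atom i]) by [].
  by apply/idP/idP; rewrite !inE => /(cball_atom_small i hs).
by rewrite cball_atom_large// indicT site_measure_setT inve1 !mule1 mulr1.
Qed.

Lemma integral_density i s : \int[mu]_y (density i s y)%:E = 1.
Proof.
rewrite /density; have [_/=|_/=] := ltP s 2%R; last first.
  by rewrite integral_cst// mul1e site_measure_setT.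
under eq_integral do rewrite EFinM.
rewrite ge0_integralZl_EFin ?invr_ge0//; last exact: site_measurable_fun.
rewrite integral_indic//; last exact: site_measurable.
by rewrite setIT site_measure_set1 -EFinM mulVf// gt_eqF// mass_gt0.
Qed.

(** Both radii below 2 give the same density; a dilated radius of at least 2
    gives the density 1. *)
Lemma density_dilate i (t s : R) y : (0 < s)%R -> (1 <= t)%R ->
  (density i (t * s) y <= density i s y + 1)%R.
Proof.
move=> s0 t1; rewrite {1}/density; case: ifP => ts; last first.
  by rewrite lerDr density_ge0.
rewrite /density ifT ?lerDl//; apply: le_lt_trans ts.
by rewrite ler_peMl// ltW.
Qed.

(** The two norms are computed on [F s], which is real-valued and agrees with
    the weighted ball sum on the atoms. *)
Lemma site_boman (p : R) : (1 < p)%R -> boman_covering mu p 2.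
Proof.
move=> p1 N x r w t sx r0 w0 t1; have p0 : (0 < p)%R := lt_trans ltr01 p1.
have /choice[a xE] n : exists i, x n = atom i by exact: site_support.
pose F (s : 'I_N -> R) y := (\sum_(n < N) w n * density (a n) (s n) y)%R.
have F0 s y : (0 <= F s y)%R.
  by apply: sumr_ge0 => n _; rewrite mulr_ge0 ?density_ge0// ltW.
have wF s j : (forall n, 0 < s n)%R ->
    weighted_ball_sum mu x s w (atom j) = (F s (atom j))%:E.
  move=> s0; rewrite /weighted_ball_sum /F -sumEFin; apply: eq_bigr => n _.
  by rewrite xE normalized_ball_atom.
pose c := (\sum_(n < N) w n)%R.
have c0 : (0 <= c)%R by apply: sumr_ge0 => n _; exact: ltW.
have cF : c%:E <= 'N[mu]_p%:E [EFin \o F r].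
  apply: le_trans (Lnorm1_le site_measure_setT p1 _); last first.
    exact: site_measurable_fun.
  rewrite Lnorm1; under eq_integral => y _ do
    rewrite /= ger0_norm ?F0// /F -sumEFin.
  rewrite ge0_integral_sum//; last 2 first.
  - by move=> n; exact: site_measurable_fun.
  - by move=> n y _; rewrite lee_fin mulr_ge0 ?density_ge0// ltW.
  rewrite /c -sumEFin; apply: lee_sum => n _.
  under eq_integral do rewrite EFinM.
  rewrite ge0_integralZl_EFin ?(ltW (w0 n))//.
  - by rewrite integral_density mule1.
  - by move=> y _; rewrite lee_fin density_ge0.
  - exact: site_measurable_fun.
have Nc : 'N[mu]_p%:E [EFin \o cst c] = c%:E.
  rewrite (eq_Lnorm _ _ (g := fun y => (c * \1_setT y)%:E)); last first.
    by move=> y /=; rewrite indicT mulr1.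
  by rewrite Lnorm_scale_indic// site_measure_setT poweR1r mule1.
apply: (@le_trans _ _ ('N[mu]_p%:E [EFin \o (F r \+ cst c)%R])).
  apply: Lnorm_site_le => // j; rewrite wF; last first.
    by move=> n; rewrite mulr_gt0// (lt_le_trans ltr01).
  rewrite lee_fin !ger0_norm ?F0 ?addr_ge0 ?F0//.
  rewrite /F /c /= -big_split/=; apply: ler_sum => n _.
  by rewrite -{3}(mulr1 (w n)) -mulrDr ler_pM2l// density_dilate.
apply: (le_trans (minkowski_EFin _ _ _ _)) => //.
- exact: site_measurable_fun.
- exact: ltW.
apply: (@le_trans _ _ (2%:E * 'N[mu]_p%:E [EFin \o F r])).
  by rewrite Nc mule_natl mule2n leeD2l.
rewrite lee_wpmul2l ?lee_fin//; apply: Lnorm_site_le => // j.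
by rewrite wF.
Qed.

(** * The maximal operator *)

Lemma mass_le i j : (i <= j)%N -> ((mass j)%:num <= (mass i)%:num)%R.
Proof.
move=> ij; rewrite /= lef_pV2 ?posrE ?ltr0n// ler_nat.
by rewrite leq_mul// ltnS.
Qed.

(** The witness is the ball of radius 3/2 about [link k i], whose measure is at
    most twice the mass of [atom k]. *)
Lemma maximal_atom k i : (k <= i)%N ->
  2^-1%:E <= uncentered_maximal mu \1_[set atom k] (atom i).
Proof.
move=> ki; set B := cball (link k i) (3 / 2)%R.
have Bl j : B (atom j) <-> [set atom k; atom i] (atom j).
  rewrite /B /cball /= mdist_siteE /site_dist /=; split; last first.
    by move=> [|] [->]; rewrite eqxx ?orbT /=; lra.
  by case: ifP => [/orP[] /eqP -> _|_ h]; [left|right|exfalso; lra].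
have muk : (mass k)%:num%:E <= mu B.
  rewrite -site_measure_set1; apply: le_site_measure_atoms => j ->.
  by apply/Bl; left.
have mu2k : mu B <= (2 * (mass k)%:num)%:E.
  rewrite (eq_site_measure_atoms Bl).
  apply: (@le_trans _ _ (mu [set atom k] + mu [set atom i])).
    by apply: measureU2; exact: site_measurable.
  by rewrite !site_measure_set1 -EFinD lee_fin mulr_natl mulr2n lerD2l mass_le.
apply: (@le_trans _ _
    ((\int[mu]_(z in B) `|\1_[set atom k] z|%:E) / mu B)); last first.
  apply: ereal_sup_ubound; exists (link k i, (3 / 2)%R) => //; split => //=.
    by rewrite mdist_siteE /site_dist/= eqxx orbT; lra.
  by apply: lt_le_trans muk; rewrite lte_fin mass_gt0.
under eq_integral do rewrite ger0_norm//.
rewrite integral_indic//; [|exact: site_measurable..].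
rewrite (_ : _ `&` _ = [set atom k]) ?site_measure_set1; last first.
  by apply/seteqP; split=> [y []//|y ->]; split=> //; apply/Bl; left.
move: muk mu2k; case: (mu B) => [m| |]//; rewrite !lee_fin => km mk.
have m0 : (0 < m)%R by apply: lt_le_trans km; exact: mass_gt0.
rewrite inver gt_eqF// -EFinM lee_fin ler_pdivlMr//.
by rewrite mulrC ler_pdivrMr// mulrC.
Qed.

Lemma site_maximal (q : R) : (1 < q)%R -> maximal_opnorm mu q = +oo.
Proof.
move=> q1; have q0 : (0 < q)%R := lt_trans ltr01 q1.
apply/eqP; rewrite -leye_eq; apply: le_ereal_inf_tmp => -[c| |] [];
  last 2 first.
- by [].
- by rewrite leNgt ltNy0.
rewrite lee_fin => c0 H; exfalso.
(* compares the norms of the indicator of [atom k] and of its maximal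
   function, the latter restricted to the atoms of index in [k, 2k] *)
have key k : ((k.+2%:R / 2) `^ q^-1 <= 2 * c)%R.
  pose A := [set x | exists2 i, (k <= i < k.*2.+1)%N & x = atom i].
  pose g : borel (site R) -> R := \1_[set atom k].
  have Ng : 'N[mu]_q%:E [EFin \o g] = ((mass k)%:num `^ q^-1)%:E.
    rewrite (eq_Lnorm _ _ (g := fun y => (1 * g y)%:E)); last first.
      by move=> y /=; rewrite mul1r.
    rewrite Lnorm_scale_indic ?mul1e ?site_measure_set1//.
    exact: site_measurable.
  have gL : g \in Lfun mu q%:E.
    rewrite inE; apply/andP; split; rewrite inE/=.
      exact: site_measurable_fun.
    by rewrite /finite_norm Ng ltry.
  have := H _ gL; rewrite Ng.
  have : 'N[mu]_q%:E [(fun y => (2^-1 * \1_A y)%:E)] <=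
      'N[mu]_q%:E [uncentered_maximal mu g].
    apply: Lnorm_site_le => // i; rewrite indicE.
    have [|_] := boolP (atom i \in A); last by rewrite mulr0 abse0.
    rewrite inE => -[j /andP[kj _] [ij]]; rewrite mulr1 gee0_abs//.
    have Mi := maximal_atom kj; rewrite -ij in Mi.
    by rewrite gee0_abs// (le_trans _ Mi).
  rewrite Lnorm_scale_indic//; last exact: site_measurable.
  have muA : ((mass k)%:num * (k.+2%:R / 2))%:E <= mu A.
    rewrite (_ : (_ * _)%:E = \sum_(k <= i < k.*2.+1) (mass i)%:num%:E).
      by apply: sum_mass_le_site_measure => i ki; exists i.
    rewrite sum_mass; last by rewrite -addnn ltnW// ltnS leq_addr.
    rewrite (_ : k.*2.+2 = 2 * k.+1)%N; last by rewrite mul2n.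
    rewrite /= !natrM; congr EFin.
    by field; rewrite nat1r -natrD !pnatr_eq0.
  move=> h1 h2.
  have h3 : ((mass k)%:num * (k.+2%:R / 2))%:E `^ q^-1 <= mu A `^ q^-1.
    apply: gt0_ler_poweR => //.
    - by rewrite invr_ge0 ltW.
    - by rewrite in_itv/= leey lee_fin mulr_ge0// divr_ge0.
    - by rewrite in_itv/= leey measure_ge0.
  have := lee_wpmul2l (_ : 0 <= 2^-1%:E) h3.
  rewrite lee_fin invr_ge0 ler0n => /(_ isT) h4.
  have := le_trans h4 (le_trans h1 h2).
  rewrite poweR_EFin -!EFinM lee_fin powRM//.
  rewrite mulrCA [leRHS]mulrC ler_pM2l ?powR_gt0 ?mass_gt0//.
  by rewrite ler_pdivrMl.
pose k := Num.truncn (2 * (2 * c) `^ q)%R.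
have : (k.+2%:R / 2 <= (2 * c) `^ q)%R.
  have := ge0_ler_powR (ltW q0) _ _ (key k).
  rewrite !nnegrE powR_ge0 mulr_ge0// => /(_ isT isT).
  by rewrite -powRrM mulVf ?gt_eqF// powRr1// divr_ge0.
rewrite ler_pdivrMr// mulrC leNgt => /negP; apply.
by apply: lt_trans (truncnS_gt _) _; rewrite ltr_nat.
Qed.

End site_measure.

Theorem theorem4p12 (R : realType) :
  exists (X : pmetricType R) (mu : {measure set (borel X) -> \bar R}),
    [/\ metric_measure_space mu,
        vitali_space mu,
        forall p : R, (1 < p)%R -> exists C : R, (0 < C)%R /\ boman_covering mu p C
      & forall q : R, (1 < q)%R -> maximal_opnorm mu q = +oo%E].
Proof.
exists (site R), (site_measure R); split.
- exact: site_metric_measure.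
- by apply: discrete_vitali => x; exact: site_open.
- by move=> p p1; exists 2; split=> //; exact: site_boman.
- exact: site_maximal.
Qed.
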